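(* Let $X$ be a vector space (with a topology with respect to which boundedness, lower semi-continuity and cluster points are understood), let $L\subset\mathbb{F}$ be a set of functions on $X$ (with $\mathbb{F}$ as in the context), and let $f,\phi:X\to\mathbb{R}$ be two $L$-convex functions. Let $(c_k)_{k\ge0}$ be a sequence of positive real numbers. Assume: (A1) the sublevel sets of the function $D_\phi^\lambda(\cdot,y)$ are bounded, for any $y\in X$ and any $\lambda\in\partial_L\phi(y)$; (A2) one of the following two conditions is satisfied: (a) $L-L\subset L$ and $c_k=1$ for any $k\ge1$; (b) $L$ is a linear space and $\sum_{k=1}^\infty c_k=\infty$. Let $(x_k)_{k\in\mathbb{N}}$ be the sequence of iterates produced by the abstract Bregman proximal point algorithm (described in the context), and suppose that the sum rule applies (in the sense defined in the context). Let $X^*$ be the set of minimisers of $f$ over $X$. If $X^*$ is not empty and $f$ is lower semi-continuous, then every cluster point of the sequence $(x_k)$ belongs to $X^*$.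
   Context: Let $\mathbb{F}$ be the set of all functions $X\to\mathbb{R}\cup\{+\infty\}$ together with the function identically equal to $-\infty$, and let $L\subset\mathbb{F}$. $L$-convexity: a function $f$ is $L$-convex if there is $U\subseteq L$ with $f(x)=\sup_{u\in U}u(x)$ for every $x\in X$. $L$-subdifferential: $\partial_L f(x)=\{l\in L:\ f(y)\ge f(x)+l(y)-l(x)\ \text{for all } y\in X\}$. Abstract Bregman divergence: for an $L$-convex $\phi:X\to\mathbb{R}$, $x,y\in X$ and $\lambda\in\partial_L\phi(y)$, $D_\phi^{\lambda}(x,y)=\phi(x)-\phi(y)-(\lambda(x)-\lambda(y))$. The sublevel sets of a function $h$ on $X$ are the sets $\{x\in X:h(x)\le c\}$. Sums and differences of sets of functions are elementwise, e.g. $L-L=\{l-l': l,l'\in L\}$. Abstract Bregman proximal point algorithm: select $x_0\in X$, $\lambda_0\in\partial_L\phi(x_0)$ and positive numbers $(c_k)_{k\ge0}$; set $k=0$. Repeat: pick $x_{k+1}\in\operatorname{Argmin}_{x\in X}\{f(x)+\frac1{c_k}D_\phi^{\lambda_k}(x,x_k)\}$; set $\lambda_{k+1}=\lambda_k-c_kg_{k+1}$, where $g_{k+1}\in\partial_L f(x_{k+1})$; set $k=k+1$; until $0\in\partial_L f(x_k)$. (Under (A2) and the sum rule, the $\lambda_{k+1}$-step is well defined: optimality of $x_{k+1}$ gives $g_{k+1}\in\partial_L f(x_{k+1})$ and $\lambda_{k+1}\in\partial_L\phi(x_{k+1})$ with $0=g_{k+1}+\frac1{c_k}(\lambda_{k+1}-\lambda_k)$.)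 Sum rule: for a set $K$ of functions on $X$ let $H_K=\{l+c: l\in K,\ c\in\mathbb{R}\}$, and for a set $H$ of functions on $X$ and a function $h$ let $\operatorname{supp}(h,H)=\{u\in H: u(x)\le h(x)\ \text{for all } x\in X\}$. The sum rule applies to functions $f_1,f_2$ and families $L_1,L_2$ of functions on $X$ if $f_1$ is $L_1$-convex, $f_2$ is $L_2$-convex, $\operatorname{dom}f_1\cap\operatorname{dom}f_2\ne\emptyset$ (where $\operatorname{dom}h$ is the set of points at which $h$ is finite), and $$\operatorname{supp}(f_1,H_{L_1})+\operatorname{supp}(f_2,H_{L_2})=\operatorname{supp}(f_1+f_2,\,H_{L_1}+H_{L_2}).$$ ''The sum rule applies'' for the algorithm means that at every iteration $k$ it applies to $f_1=f$, $L_1=L$, $f_2=\frac1{c_k}D_\phi^{\lambda_k}(\cdot,x_k)$ and $L_2=L-\lambda_k/c_k$. *)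

(* Defs.v *)
From HB Require Import structures.
From mathcomp Require Import all_boot all_order all_algebra.
From mathcomp Require Import all_classical all_reals all_analysis.

Set Implicit Arguments.
Unset Strict Implicit.
Unset Printing Implicit Defensive.

Import Order.TTheory GRing.Theory Num.Theory.
Import numFieldNormedType.Exports.

Local Open Scope classical_set_scope.
Local Open Scope ring_scope.

Section AbstractConvexity.
Variables (R : realType) (X : Type).
Implicit Types (L K H A B U : set (X -> \bar R)) (h u l : X -> \bar R).
Local Open Scope ereal_scope.

(* Functions X -> R `|` {+oo}, together with the constant -oo. *)
Definition FF : set (X -> \bar R) :=
  [set h | (forall x, h x != -oo) \/ h = cst -oo].

Definition fset_add A B := [set a \+ b | a in A & b in B].

(* Subtraction is that of \bar R, in which (+oo) - (+oo) = -oo. *)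
Definition fset_sub A B := [set a \- b | a in A & b in B].

(* The sup of the empty family is -oo. *)
Definition Lconvex L h :=
  exists2 U, U `<=` L & forall x, h x = ereal_sup [set u x | u in U].

(* At y = x the defining inequality involves l x - l x, so it only makes sense
   when l x is finite, which is therefore required explicitly. *)
Definition subdiff L (f : X -> R) (x : X) : set (X -> \bar R) :=
  [set l | [/\ L l, l x \is a fin_num
             & forall y, (f x)%:E + l y - l x <= (f y)%:E]].

(* D_phi^lam(x, y); it is a divergence only when lam \in subdiff L phi y. *)
Definition bregman (phi : X -> R) (lam : X -> \bar R) (x y : X) : \bar R :=
  (phi x)%:E - (phi y)%:E - (lam x - lam y).

Definition Hset K :=
  [set (fun x => l x + r%:E) | l in K & r in [set: R]].

Definition suppset h H := [set u | H u /\ forall x, u x <= h x].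

Definition edom h := [set x | h x \is a fin_num].

Definition sum_rule f1 f2 L1 L2 :=
  [/\ Lconvex L1 f1, Lconvex L2 f2, edom f1 `&` edom f2 !=set0
    & fset_add (suppset f1 (Hset L1)) (suppset f2 (Hset L2)) =
      suppset (f1 \+ f2) (fset_add (Hset L1) (Hset L2))].

Definition argmin h := [set x | forall y, h x <= h y].

(* L is a linear subspace of the space of real-valued functions on X. *)
Definition linear_space L :=
  [/\ forall l x, L l -> l x \is a fin_num, L (cst 0)
    & forall (a : R) l l', L l -> L l' -> L (fun x => a%:E * l x + l' x)].

Section Algorithm.
Variables (L : set (X -> \bar R)) (f phi : X -> R) (c : nat -> R).
Variables (x : nat -> X) (lam : nat -> X -> \bar R).

(* The function y |-> (1 / c_k) D_phi^{lam_k}(y, x_k). *)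
Definition prox_term (k : nat) : X -> \bar R :=
  fun y => (c k)^-1%:E * bregman phi (lam k) y (x k).

(* The test 0 \in subdiff L f (x j) is made at the end of each pass of the loop,
   hence only for j >= 1. *)
Definition stopped (k : nat) :=
  exists2 j, (1 <= j <= k)%N & subdiff L f (x j) (cst 0).

(* The new lam is required to be a subgradient of phi at the new iterate:
   g has to be the one given by the optimality of x k.+1, since otherwise the
   next divergence would be undefined. *)
Definition prox_step (k : nat) :=
  argmin (EFin \o f \+ prox_term k) (x k.+1) /\
  exists g, [/\ subdiff L f (x k.+1) g,
    lam k.+1 = (fun y => lam k y - (c k)%:E * g y)
    & subdiff L phi (x k.+1) (lam k.+1)].

(* A run that stops is continued by its last iterate. *)
Definition prox_run :=
  subdiff L phi (x 0%N) (lam 0%N) /\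
  forall k, (~ stopped k -> prox_step k) /\ (stopped k -> x k.+1 = x k).

Definition sum_rule_applies :=
  forall k, ~ stopped k ->
    sum_rule (EFin \o f) (prox_term k)
      L (fset_sub L [set (fun y => (c k)^-1%:E * lam k y)]).

End Algorithm.
End AbstractConvexity.

(* Von Neumann boundedness: A is absorbed by every neighbourhood of 0. *)
Definition vn_bounded (R : realType) (X : preTopologicalLmodType R)
    (A : set X) :=
  forall V : set X, nbhs 0 V -> exists2 r : R, 0 < r &
    forall t : R, r <= `|t| -> A `<=` [set t *: v | v in V].

(* Main.v *)
(* Subgradients are finite everywhere, because a member of FF that is finite at
   one point never takes the value -oo and the subgradient inequality bounds it
   above. Hence for a minimiser p of f the usual three-point computation gives
     c_k (f x_(k+1) - f p) <= D^(lam_k)(p, x_k) - D^(lam_(k+1))(p, x_(k+1)),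
   and f x_k is nonincreasing because D >= 0. Summing, the divergence of
   sum c_k forces f x_k to converge to the minimum, and lower semicontinuity
   passes this to cluster points. *)
Require Import Defs.
From mathcomp Require Import all_boot all_order all_algebra.
From mathcomp Require Import all_classical all_reals all_analysis.
From mathcomp Require Import lra.
Import Order.TTheory GRing.Theory Num.Theory.
Local Open Scope classical_set_scope.
Local Open Scope ring_scope.

Set Implicit Arguments.
Unset Strict Implicit.

Lemma subdiff_fin (R : realType) (X : Type) (L : set (X -> \bar R))
    (h : X -> R) (x y : X) (l : X -> \bar R) :
  L `<=` @FF R X -> subdiff L h x l -> l y \is a fin_num.
Proof.
move=> LF [Ll lx hl]; case: (LF _ Ll) => [lNy|lE]; last first.
  by move: lx; rewrite lE.
move: (hl y) (lNy y); move: lx; case: (l x) => // r _.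
by case: (l y).
Qed.

(** Moves subgradients from [\bar R] to [R], so that the inequalities below become linear arithmetic
    over the reals. *)
Lemma subdiffE (R : realType) (X : Type) (L : set (X -> \bar R))
    (h : X -> R) (x : X) (l : X -> \bar R) :
  L `<=` @FF R X -> subdiff L h x l ->
  exists2 u : X -> R, l = EFin \o u & forall y, h x + u y - u x <= h y.
Proof.
move=> LF hl; exists (fine \o l).
  by apply/funext => y /=; rewrite fineK// (subdiff_fin _ _ hl).
have [_ _ ineq] := hl => y; rewrite -lee_fin EFinB EFinD.
by rewrite !fineK ?(subdiff_fin _ LF hl).
Qed.

Lemma bregman_ge0 (R : realType) (X : Type) (L : set (X -> \bar R))
    (phi : X -> R) (l : X -> \bar R) (x y : X) :
  L `<=` @FF R X -> subdiff L phi y l -> (0 <= bregman phi l x y)%E.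
Proof.
move=> LF hl; have [u -> ineq] := subdiffE LF hl.
by rewrite /bregman/= -!EFinB lee_fin; have := ineq x; lra.
Qed.

(** The point [x k] competes in the argmin with divergence zero, while [x k.+1] pays a nonnegative
    divergence. *)
Lemma prox_step_le (R : realType) (X : Type) (L : set (X -> \bar R))
    (f phi : X -> R) (c : nat -> R) (x : nat -> X) (lam : nat -> X -> \bar R)
    (k : nat) :
  L `<=` @FF R X -> 0 < c k -> subdiff L phi (x k) (lam k) ->
  prox_step L f phi c x lam k -> f (x k.+1) <= f (x k).
Proof.
move=> LF ck hl [/(_ (x k)) + _].
rewrite /prox_term/=.
have := bregman_ge0 (x k.+1) LF hl.
have [u -> _] := subdiffE LF hl.
rewrite /bregman/= -!EFinB -!EFinM -!EFinD !lee_fin => D0.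
rewrite !subrr mulr0 addr0; apply: le_trans.
by rewrite lerDl mulr_ge0// invr_ge0 ltW.
Qed.

(** With [g] the subgradient of [f] at [x k.+1], the right-hand side equals the divergence of
    [x k.+1] from [x k] minus [c k * (g p - g (x k.+1))]. The first term is nonnegative by the
    subgradient inequality for [phi]; the second is bounded by the one for [f] at [p]. *)
Lemma prox_step_descent (R : realType) (X : Type) (L : set (X -> \bar R))
    (f phi : X -> R) (c : nat -> R) (x : nat -> X) (lam : nat -> X -> \bar R)
    (k : nat) (p : X) :
  L `<=` @FF R X -> 0 < c k -> subdiff L phi (x k) (lam k) ->
  prox_step L f phi c x lam k ->
  c k * (f (x k.+1) - f p) <=
    fine (bregman phi (lam k) p (x k)) -
    fine (bregman phi (lam k.+1) p (x k.+1)).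
Proof.
move=> LF ck hl [_ [g [hg -> _]]].
have [u -> hu] := subdiffE LF hl; have [v -> hv] := subdiffE LF hg.
rewrite /bregman/=.
have := hu (x k.+1).
have : 0 <= c k * (f p - f (x k.+1) - (v p - v (x k.+1))).
  by apply: mulr_ge0; [exact: ltW|have := hv p; lra].
lra.
Qed.

(** If [F] stayed above [a], each step would lower [d] by at least [c k * (a - m)]; as [d] is
    nonnegative, the sums of [c] from 1 on could not exceed [d 1 / (a - m)]. *)
Lemma bounded_sums_small_term (R : realType) (c d F : nat -> R) (m a : R) :
  (forall k, 0 < c k) -> (forall k, 0 <= d k) ->
  (forall k, c k * (F k.+1 - m) <= d k - d k.+1) ->
  (forall M, exists n, M < \sum_(1 <= k < n) c k) -> m < a ->
  exists k, F k <= a.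
Proof.
move=> c0 d0 dF cdiv ma; apply/not_existsP => Fa.
have am : 0 < a - m by rewrite subr_gt0.
have [n] := cdiv (d 1%N / (a - m)); apply/negP; rewrite -leNgt.
rewrite ler_pdivlMr//.
(* The [maxn] covers [n = 0], where the sum is empty and the telescoped difference must vanish. *)
suff: (\sum_(1 <= k < n) c k) * (a - m) <= d 1%N - d (maxn 1 n).
  by have := d0 (maxn 1 n); lra.
case: n => [|n]; first by rewrite big_geq//= mul0r subrr.
rewrite (maxn_idPr _)//; elim: n => [|n IH].
  by rewrite big_geq// mul0r subrr.
rewrite big_nat_recr//= mulrDl.
have := dF n.+1; have : c n.+1 * (a - m) <= c n.+1 * (F n.+2 - m).
  rewrite ler_pM2l// lerD2r; have /negP := Fa n.+2.
  by rewrite -ltNge => /ltW.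
lra.
Qed.

Lemma nneseries_pinfty_partial_gt (R : realType) (c : nat -> R) (m : nat) :
  (forall k, 0 <= c k) -> (\sum_(m <= k <oo) (c k)%:E = +oo)%E ->
  forall M, exists n, M < \sum_(m <= k < n) c k.
Proof.
move=> c0 coo M; apply/not_existsP => cM.
suff: (\sum_(m <= k <oo) (c k)%:E <= M%:E)%E by rewrite coo leye_eq.
apply: lime_le; first by apply: is_cvg_nneseries => k _ _; rewrite lee_fin.
apply: nearW => n; rewrite sumEFin lee_fin leNgt; exact/negP/cM.
Qed.

Lemma cluster_lsc_le (R : realType) (X : topologicalType) (h : X -> R)
    (x : nat -> X) (a : R) (z : X) :
  lower_semicontinuous (EFin \o h) -> (\forall k \near \oo, h (x k) <= a) ->
  cluster (x @ \oo) z -> h z <= a.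
Proof.
move=> hlsc ha xz; rewrite leNgt; apply/negP => az.
have [V zV Va] := hlsc z a az.
have [y [/= ya /Va]] := xz [set y | h y <= a] V ha zV.
by rewrite lte_fin ltNge ya.
Qed.

Unset Implicit Arguments.
Set Strict Implicit.

Theorem theorem4 (R : realType) (X : preTopologicalLmodType R)
  (L : set (X -> \bar R)) (f phi : X -> R) (c : nat -> R)
  (x : nat -> X) (lam : nat -> X -> \bar R)
  (LF : L `<=` @FF R X)
  (f_conv : Lconvex L (EFin \o f)) (phi_conv : Lconvex L (EFin \o phi))
  (c_gt0 : forall k, 0 < c k)
  (A1 : forall (y : X) (l : X -> \bar R), subdiff L phi y l ->
     forall r : R, vn_bounded [set z | (bregman phi l z y <= r%:E)%E])
  (A2 : (fset_sub L L `<=` L /\ forall k, (1 <= k)%N -> c k = 1) \/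
        (linear_space L /\ (\sum_(1 <= k <oo) (c k)%:E = +oo)%E))
  (run : prox_run L f phi c x lam)
  (sumrule : sum_rule_applies L f phi c x lam)
  (min_neq0 : argmin (EFin \o f) !=set0)
  (f_lsc : lower_semicontinuous (EFin \o f)) :
  cluster (x @ \oo) `<=` argmin (EFin \o f).
Proof.
move=> z xz p.
have [q qmin] := min_neq0; apply: le_trans (qmin p).
rewrite lee_fin; apply/ler_addgt0Pr => e e0.
apply: (cluster_lsc_le f_lsc _ xz).
have [lam0 step] := run.
(* A run that stops is constant from the stopping index [j] on, and a zero subgradient at [x j]
   makes [x j] a minimiser. *)
have [[k0 stop]|nstop] := pselect (exists k, stopped L f x k).
  have [j /andP[j1 jk] js] := stop.
  exists j => // n /= jn; have -> : x n = x j.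
    elim: n jn => [|n IH]; first by rewrite leqn0 => /eqP ->.
    rewrite leq_eqVlt => /predU1P[->//|jn]; rewrite -IH//.
    by apply: (step n).2; exists j; rewrite ?j1.
  have [_ _ /(_ q)] := js; rewrite /cst adde0 sube0 lee_fin => /le_trans.
  by apply; rewrite lerDl ltW.
have {}step k : prox_step L f phi c x lam k.
  by apply: (step k).1 => sk; apply: nstop; exists k.
have sub k : subdiff L phi (x k) (lam k).
  by case: k => // k; have [_ [g []]] := step k.
have fdec k : f (x k.+1) <= f (x k) by exact: prox_step_le (sub k) (step k).
(* Both alternatives of [A2] are used only through the unboundedness of these partial sums. *)
have cdiv M : exists n, M < \sum_(1 <= k < n) c k.
  case: A2 => [[_ c1]|[_ coo]]; last first.
    by apply: nneseries_pinfty_partial_gt => // k; exact: ltW.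
  (* The sum starts at 1, so it has one term fewer than this bound: its value is the truncation of
     the absolute value of [M], plus 1. *)
  exists (Num.truncn `|M|).+2; apply: (le_lt_trans (ler_norm M)).
  rewrite (eq_big_nat _ _ (F2 := fun=> 1)) => [|k /andP[/c1]//].
  by rewrite sumr_const_nat subn1/= truncnS_gt.
have [k fk] : exists k, f (x k) <= f q + e.
  apply: (bounded_sums_small_term (F := f \o x) (m := f q)
    (d := fun k => fine (bregman phi (lam k) q (x k))) c_gt0 _ _ cdiv).
  - by move=> k; apply: fine_ge0; exact: bregman_ge0 (sub k).
  - by move=> k; exact: prox_step_descent (sub k) (step k).
  - by rewrite ltrDl.
(* One small value is enough: monotonicity of [f (x k)] carries the bound to all later iterates. *)
exists k => // n /= kn; apply: le_trans fk.
elim: n kn => [|n IH]; first by rewrite leqn0 => /eqP ->.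
rewrite leq_eqVlt => /predU1P[->//|/IH]; exact: le_trans (fdec n).
Qed.
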